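(* Let $\sigma=\{\sigma_i \mid i\in I\}$ be a partition of the set $\mathbb{P}$ of all primes and let $G$ be a finite group. Suppose that $G$ has a normal $\sigma$-Hall subgroup $D$ such that: (i) $G/D$ is a $P\sigma T$-group, and (ii) every $\sigma$-subnormal subgroup of $D$ is normal in $G$. If $G$ is a $\sigma$-full group of Sylow type, then $G$ is a $P\sigma T$-group.
   Context: All groups are finite. $\sigma=\{\sigma_i\mid i\in I\}$ is a partition of $\mathbb{P}$: $\mathbb{P}=\bigcup_{i\in I}\sigma_i$ and $\sigma_i\cap\sigma_j=\emptyset$ for $i\neq j$. For a natural number $n$, $\sigma(n)=\{\sigma_i \mid \sigma_i\cap\pi(n)\neq\emptyset\}$, where $\pi(n)$ is the set of primes dividing $n$; $\sigma(G)=\sigma(|G|)$. For $\Pi\subseteq\sigma$, $\Pi'=\sigma\setminus\Pi$; $n$ is a $\Pi$-number if $\sigma(n)\subseteq\Pi$. A subgroup $A$ of $G$ is a Hall $\Pi$-subgroup if $|A|$ is a $\Pi$-number and $|G:A|$ is a $\Pi'$-number; it is a $\sigma$-Hall subgroup if it is a Hall $\Pi$-subgroup for some $\Pi\subseteq\sigma$. A Hall $\sigma_i$-subgroup means a Hall $\{\sigma_i\}$-subgroup. A group is $\sigma$-primary if $|\sigma(G)|\le 1$. For a set of primes $\pi$, $G$ is a $D_\pi$-group if $G$ has a Hall $\pi$-subgroup $E$ and every $\pi$-subgroup of $G$ lies in some conjugate of $E$. $G$ is a $\sigma$-full group of Sylow type if every subgroup $E$ of $G$ is a $D_{\sigma_i}$-group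 for every $\sigma_i\in\sigma(E)$. A complete Hall $\sigma$-set of $G$ is a set $\mathcal{H}$ of subgroups such that every nontrivial member is a Hall $\sigma_i$-subgroup of $G$ for some $i$, and $\mathcal{H}$ contains exactly one Hall $\sigma_i$-subgroup of $G$ for each $\sigma_i\in\sigma(G)$. A subgroup $A$ of $G$ is $\sigma$-quasinormal ($\sigma$-permutable) in $G$ if $G$ has a complete Hall $\sigma$-set $\mathcal{H}$ with $AH^x=H^xA$ for all $H\in\mathcal{H}$ and $x\in G$. A subgroup $A$ is $\sigma$-subnormal in $G$ if there is a chain $A=A_0\le A_1\le\cdots\le A_t=G$ such that for each $i$ either $A_{i-1}\trianglelefteq A_i$ or $A_i/(A_{i-1})_{A_i}$ is $\sigma$-primary, where $(A_{i-1})_{A_i}$ is the core of $A_{i-1}$ in $A_i$. $G$ is a $P\sigma T$-group if $\sigma$-quasinormality is transitive in $G$: whenever $K$ is $\sigma$-quasinormal in $H$ and $H$ is $\sigma$-quasinormal in $G$, $K$ is $\sigma$-quasinormal in $G$. *)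

(* Defs.v *)
From mathcomp Require Import all_boot all_fingroup all_solvable.
Set Implicit Arguments. Unset Strict Implicit. Unset Printing Implicit Defensive.

Local Open Scope group_scope.

(* A partition sigma = {sigma_i | i in I} of the set of primes is encoded by a
   map s : nat -> nat sending each prime p to the index i of the unique class
   sigma_i containing p (values on non-primes are irrelevant). *)

Definition sigma_i (s : nat -> nat) (i : nat) : nat_pred := [pred p | s p == i].

Definition sigma_of (s : nat -> nat) (n : nat) : seq nat := undup (map s (primes n)).

Definition sigma_primary (s : nat -> nat) (gT : finGroupType) (X : {set gT}) : Prop :=
  size (sigma_of s #|X|) <= 1.

Definition pi_of (s : nat -> nat) (Pi : pred nat) : nat_pred := [pred p | Pi (s p)].

Definition Hall_Pi (s : nat -> nat) (Pi : pred nat) (gT : finGroupType)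
  (G A : {set gT}) : bool := (pi_of s Pi).-Hall(G) A.

Definition sigma_Hall (s : nat -> nat) (gT : finGroupType) (G A : {set gT}) : Prop :=
  exists Pi : pred nat, Hall_Pi s Pi G A.

Definition D_pi (pi : nat_pred) (gT : finGroupType) (G : {group gT}) : Prop :=
  exists2 E : {group gT}, pi.-Hall(G) E &
    forall K : {group gT}, pi.-subgroup(G) K -> exists2 x, x \in G & K \subset E :^ x.

Definition sigma_full (s : nat -> nat) (gT : finGroupType) (G : {group gT}) : Prop :=
  forall E : {group gT}, E \subset G ->
    forall i, i \in sigma_of s #|E| -> D_pi (sigma_i s i) E.

Definition complete_Hall_set (s : nat -> nat) (gT : finGroupType) (G : {group gT})
  (HH : {set {group gT}}) : Prop :=
  (forall H : {group gT}, H \in HH -> (H : {set gT}) != 1 ->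
     exists i, (sigma_i s i).-Hall(G) H) /\
  (forall i, i \in sigma_of s #|G| ->
     exists! H : {group gT}, H \in HH /\ (sigma_i s i).-Hall(G) H).

Definition sigma_quasinormal (s : nat -> nat) (gT : finGroupType)
  (A G : {group gT}) : Prop :=
  A \subset G /\
  exists HH : {set {group gT}}, complete_Hall_set s G HH /\
    forall (H : {group gT}) (x : gT), H \in HH -> x \in G ->
      A * (H :^ x) = (H :^ x) * A.

Inductive sigma_subnormal (s : nat -> nat) (gT : finGroupType) (A : {group gT})
  : {group gT} -> Prop :=
| ssn_refl : sigma_subnormal s A A
| ssn_step (B C : {group gT}) :
    sigma_subnormal s A B -> B \subset C ->
    (B <| C \/ sigma_primary s (C / gcore B C)) ->
    sigma_subnormal s A C.

Definition PsT (s : nat -> nat) (gT : finGroupType) (G : {group gT}) : Prop :=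
  forall K H : {group gT},
    sigma_quasinormal s K H -> sigma_quasinormal s H G -> sigma_quasinormal s K G.

(* Main.v *)
(** Since G is sigma-full of Sylow type, its Hall sigma_i-subgroups are conjugate,
    so sigma-quasinormality means permuting with all of them, and it implies
    sigma-subnormality. Hence if K is sigma-quasinormal in H and H in G, then
    N := K :&: D is sigma-subnormal in D, so normal in G. Modulo N, K is a
    sigma-subnormal Hall subgroup of K D, so K is normal in K D and centralises D.
    A Hall sigma_i-subgroup Q either lies in D, and normalises K, or has order
    prime to |D|, and then K Q = Q K lifts from G / D. *)
Require Import Defs.
From mathcomp Require Import all_boot all_fingroup all_solvable.
Set Implicit Arguments. Unset Strict Implicit. Unset Printing Implicit Defensive.
Local Open Scope group_scope.

(** * Arithmetic of the classes of sigma *)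

Lemma mem_sigma_of (s : nat -> nat) (n i : nat) :
  reflect (exists2 p, p \in primes n & i = s p) (i \in sigma_of s n).
Proof. by rewrite mem_undup; apply: mapP. Qed.

Lemma sigma_of_pnatN (s : nat -> nat) (n i : nat) :
  0 < n -> i \notin sigma_of s n -> (sigma_i s i)^'.-nat n.
Proof.
move=> n_gt0 niN; apply/pnatP=> // p p_pr p_n; apply/negP=> /eqP sp_i.
by case/mem_sigma_of: niN; exists p; rewrite // mem_primes p_pr n_gt0.
Qed.

Lemma sigma_i_pnatN (s : nat -> nat) (i j n : nat) :
  i != j -> (sigma_i s i).-nat n -> (sigma_i s j)^'.-nat n.
Proof.
move=> neq_ij; apply: sub_in_pnat => p _ /eqP s_p.
by rewrite inE /= /in_mem /= s_p.
Qed.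

Lemma pgroup_sigma_i (s : nat -> nat) (p : nat) (gT : finGroupType)
    (P : {set gT}) :
  p.-group P -> (sigma_i s (s p)).-group P.
Proof.
by apply: sub_in_pnat => q _ /eqP->; rewrite /in_mem /= eqxx.
Qed.

Lemma sigma_primaryP (s : nat -> nat) (gT : finGroupType) (G : {group gT}) :
  sigma_primary s G <-> exists i, (sigma_i s i).-group G.
Proof.
rewrite /sigma_primary /pgroup; split=> [|[i /pnatP piG]].
  have sG p : prime p -> p %| #|G| -> s p \in sigma_of s #|G|.
    move=> p_pr p_G.
    by apply/mem_sigma_of; exists p; rewrite // mem_primes p_pr cardG_gt0.
  (* When no class meets the order, [G] is trivial and the index [0] is an arbitrary choice. *)
  case Ds: (sigma_of s _) sG => [|i [|j r]] //= sG _; [exists 0 | exists i].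
    by apply/pnatP=> // p p_pr p_G; have := sG p p_pr p_G.
  by apply/pnatP=> // p p_pr p_G; have := sG p p_pr p_G; rewrite inE.
rewrite -[1%N]/(size [:: i]); apply: uniq_leq_size; first exact: undup_uniq.
move=> j /mem_sigma_of[p + ->]; rewrite mem_primes => /and3P[p_pr _ p_G].
by rewrite inE; apply: piG.
Qed.

(** * Hall subgroups of sigma-full groups *)

Lemma sigma_full_sub (s : nat -> nat) (gT : finGroupType) (G H : {group gT}) :
  H \subset G -> sigma_full s G -> sigma_full s H.
Proof. by move=> sHG fullG E sEH; apply: fullG; apply: subset_trans sHG. Qed.

(** The D-property is given only for classes that meet the order; for any other class [S] is trivial
    and [1] is a Hall subgroup. With [S] trivial this yields existence of Hall subgroups for every
    index. *)
Lemma sigma_full_sub_Hall (s : nat -> nat) (gT : finGroupType) (G S : {group gT})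
    (i : nat) :
  sigma_full s G -> (sigma_i s i).-subgroup(G) S ->
  exists2 E : {group gT}, (sigma_i s i).-Hall(G) E & S \subset E.
Proof.
move=> fullG /[dup] piS /andP[sSG pS].
have [iG | iNG] := boolP (i \in sigma_of s #|G|).
  have [E hallE] := fullG G (subxx G) i iG.
  case/(_ S piS)=> x Gx sSEx; exists (E :^ x)%G => //.
  by rewrite pHallJ.
have p'G := sigma_of_pnatN (cardG_gt0 G) iNG.
exists 1%G; first by rewrite pHallE sub1G cards1 /= part_p'nat.
by rewrite (card1_trivg (pnat_1 pS (pgroupS sSG p'G))).
Qed.

Lemma sigma_full_Hall_conj (s : nat -> nat) (gT : finGroupType)
    (G A B : {group gT}) (i : nat) :
  sigma_full s G -> (sigma_i s i).-Hall(G) A -> (sigma_i s i).-Hall(G) B ->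
  exists2 x, x \in G & A :=: B :^ x.
Proof.
move=> fullG hallA hallB.
have [iG | iNG] := boolP (i \in sigma_of s #|G|); last first.
  have p'G := sigma_of_pnatN (cardG_gt0 G) iNG.
  have triv (C : {group gT}) : (sigma_i s i).-Hall(G) C -> C :=: 1.
    case/and3P=> sCG pC _.
    exact: card1_trivg (pnat_1 pC (pgroupS sCG p'G)).
  exists 1; first exact: group1.
  by rewrite conjsg1 (triv A hallA) (triv B hallB).
have [E hallE Econj] := fullG G (subxx G) i iG.
have conjE (C : {group gT}) : (sigma_i s i).-Hall(G) C ->
    exists2 x, x \in G & C :=: E :^ x.
  move=> hallC; have [sCG pC _] := and3P hallC.
  have [|x Gx sCEx] := Econj C; first by apply/andP.
  exists x => //; apply/eqP; rewrite eqEcard sCEx cardJg.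
  by rewrite (card_Hall hallC) (card_Hall hallE) leqnn.
have [x Gx ->] := conjE A hallA; have [y Gy ->] := conjE B hallB.
by exists (y^-1 * x); rewrite ?groupM ?groupV // -conjsgM mulKVg.
Qed.

(** * Permutability with all Hall subgroups of the classes *)

(** This form involves no choice of a complete Hall set, and no conjugates, since [Q] already ranges
    over them. *)
Definition Hall_permutable (s : nat -> nat) (gT : finGroupType)
    (G A : {group gT}) : Prop :=
  forall (i : nat) (Q : {group gT}), (sigma_i s i).-Hall(G) Q -> commute A Q.

Lemma sigma_quasinormal_Hall_permutable (s : nat -> nat) (gT : finGroupType)
    (G A : {group gT}) :
  sigma_full s G ->
  sigma_quasinormal s A G <-> A \subset G /\ Hall_permutable s G A.
Proof.
move=> fullG; split=> [[sAG [HH [[_ HHex] HHperm]]] | [sAG permA]]; split=> //.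
  move=> i Q hallQ.
  have [iG | iNG] := boolP (i \in sigma_of s #|G|).
    have [H [[HH_H hallH] _]] := HHex i iG.
    have [x Gx ->] := sigma_full_Hall_conj fullG hallQ hallH.
    exact: HHperm.
  have [sQG pQ _] := and3P hallQ.
  have p'G := sigma_of_pnatN (cardG_gt0 G) iNG.
  rewrite (card1_trivg (pnat_1 pQ (pgroupS sQG p'G))).
  exact: commute1.
(* The default [1] is never reached: [hallh] shows that a Hall subgroup exists for every [i]. *)
pose h i := odflt 1%G [pick H : {group gT} | (sigma_i s i).-Hall(G) H].
have hallh i : (sigma_i s i).-Hall(G) (h i).
  rewrite /h; case: pickP => //= noH.
  have [|E hallE _] := @sigma_full_sub_Hall s gT G 1%G i fullG.
    by rewrite /psubgroup sub1G pgroup1.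
  by rewrite noH in hallE.
exists [set H : {group gT} | has (fun i => H == h i) (sigma_of s #|G|)].
split; last first.
  move=> H x; rewrite inE => /hasP[i _ /eqP->] Gx.
  by apply: (permA i (h i :^ x)%G); rewrite pHallJ.
split=> [H | i iG].
  by rewrite inE => /hasP[i _ /eqP->] _; exists i.
exists (h i); split; first by rewrite inE; split=> //; apply/hasP; exists i.
move=> H [] /[!inE] /hasP[j _ /eqP-> hallj].
have [-> // | neq_ij] := eqVneq i j.
have /mem_sigma_of[p] := iG; rewrite mem_primes => /and3P[p_pr _ pG] Dsp.
(* Were [h j] also Hall for the class [i], it would be trivial, although a prime [p] of that class
   divides the order of [G]. *)
have h1 : #|h j| = 1%N.
  apply: pnat_1 (pHall_pgroup hallj) (sigma_i_pnatN _ (pHall_pgroup (hallh j))).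
  by rewrite eq_sym.
have := card_Hall hallj; rewrite h1 => /esym/eqP; rewrite partn_eq1 //.
by move/pnatP=> /(_ (cardG_gt0 G) p p_pr pG); case/negP; apply/eqP.
Qed.

(** A Hall subgroup [Q] of [M] is [E :&: M] for a Hall subgroup [E] of [G]. By Dedekind's law
    [A * Q] and [Q * A] are the intersections of [A * E] and [E * A] with [M]. *)
Lemma Hall_permutable_sub (s : nat -> nat) (gT : finGroupType)
    (G M A : {group gT}) :
  sigma_full s G -> A \subset M -> M \subset G ->
  Hall_permutable s G A -> Hall_permutable s M A.
Proof.
move=> fullG sAM sMG permA i Q hallQ; have [sQM pQ _] := and3P hallQ.
have [|E hallE sQE] := @sigma_full_sub_Hall s gT G Q i fullG.
  by apply/andP; split=> //; apply: subset_trans sMG.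
have DQ : E :&: M = Q.
  apply: (@sub_pHall _ _ Q M (E :&: M)%G hallQ).
  - exact: pgroupS (subsetIl E M) (pHall_pgroup hallE).
  - by rewrite subsetI sQE.
  - exact: subsetIr.
rewrite /commute -{1}DQ group_modl // (permA i E hallE) setIC -group_modr //.
by rewrite setIC DQ.
Qed.

(** * Sigma-subnormal subgroups *)

(** This spares computing cores: any normal [X] inside [B] lies in the core, so its index bounds
    that of the core. *)
Lemma sigma_primary_gcore (s : nat -> nat) (gT : finGroupType)
    (B C X : {group gT}) (i : nat) :
  X <| C -> X \subset B -> (sigma_i s i).-nat #|C : X| ->
  sigma_primary s (C / gcore B C).
Proof.
case/andP=> _ nXC sXB pX; apply/sigma_primaryP; exists i.
rewrite /pgroup card_quotient ?gcore_norm //.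
by apply: pnat_dvd pX; rewrite indexgS // gcore_max.
Qed.

Lemma sigma_primary_gcoreP (s : nat -> nat) (gT : finGroupType)
    (B C : {group gT}) :
  sigma_primary s (C / gcore B C) ->
  exists i, (sigma_i s i).-nat #|C : gcore B C|.
Proof.
case/sigma_primaryP=> i; rewrite /pgroup card_quotient ?gcore_norm //.
by exists i.
Qed.

Lemma sigma_subnormal_sub (s : nat -> nat) (gT : finGroupType)
    (A G : {group gT}) :
  sigma_subnormal s A G -> A \subset G.
Proof.
by elim=> [//|B C _ sAB sBC _]; apply: subset_trans sAB sBC.
Qed.

Lemma sigma_subnormal_trans (s : nat -> nat) (gT : finGroupType)
    (A B C : {group gT}) :
  sigma_subnormal s A B -> sigma_subnormal s B C -> sigma_subnormal s A C.
Proof.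
move=> ssnAB; elim=> [//|X Y _ ssnAX sXY stepXY].
exact: ssn_step ssnAX sXY stepXY.
Qed.

Lemma sigma_subnormal_setI (s : nat -> nat) (gT : finGroupType)
    (A G M : {group gT}) :
  sigma_subnormal s A G -> sigma_subnormal s (A :&: M)%G (G :&: M)%G.
Proof.
elim=> [|B C _ ssnAB sBC stepBC]; first exact: ssn_refl.
have nIM (X : {group gT}) : X <| C -> X :&: M <| C :&: M.
  case/andP=> sXC nXC; apply/andP; split; first exact: setSI.
  apply: normsI; first exact: subset_trans (subsetIl C M) nXC.
  exact: subset_trans (subsetIr C M) (normG M).
apply: ssn_step ssnAB _ _; first exact: setSI.
case: stepBC => [nBC | /sigma_primary_gcoreP[i piC]]; first by left; apply: nIM.
have nXC := gcore_normal sBC; right.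
apply: (@sigma_primary_gcore _ _ _ _ (gcore B C :&: M)%G i).
- exact: nIM.
- by rewrite setSI ?gcore_sub.
(* Hence the index in question is the order of the image of [C :&: M] in [C / gcore B C]. *)
have sIC: C :&: M :&: gcore B C = gcore B C :&: M.
  by rewrite setIAC (setIidPr (normal_sub nXC)).
have nXCM := subset_trans (subsetIl C M) (normal_norm nXC).
rewrite /= -sIC indexgI -card_quotient //.
apply: pnat_dvd piC; rewrite -card_quotient ?normal_norm //.
by rewrite cardSg // quotientS // subsetIl.
Qed.

Lemma sigma_subnormal_quotient (s : nat -> nat) (gT : finGroupType)
    (A G N : {group gT}) :
  G \subset 'N(N) -> sigma_subnormal s A G ->
  sigma_subnormal s (A / N)%G (G / N)%G.
Proof.
move=> nNG ssnAG; elim: ssnAG nNG => [_|B C _ IH sBC stepBC nNC].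
  exact: ssn_refl.
apply: ssn_step (IH (subset_trans sBC nNC)) _ _; first exact: quotientS.
case: stepBC => [nBC | /sigma_primary_gcoreP[i piC]].
  by left; apply: quotient_normal.
right; apply: (@sigma_primary_gcore _ _ _ _ (gcore B C / N)%G i).
- exact: quotient_normal (gcore_normal sBC).
- exact: quotientS (gcore_sub _ _).
apply: pnat_dvd piC; apply: index_quotient.
by rewrite subIset ?nNC.
Qed.

(** Induction along the chain: [A] is normal in [B], hence equal to the characteristic subgroup
    ['O_Pi(B)], which settles [B <| C]. Otherwise [C / gcore B C] belongs to one class [i]. If [i]
    is in [Pi], then [#|C : B|] is both a Pi- and a Pi'-number, so [B = C]. If not, [A] has trivial
    image there, so it is a normal Hall subgroup of the core, and characteristic in it. *)
Lemma sigma_subnormal_Hall_normal (s : nat -> nat) (Pi : pred nat)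
    (gT : finGroupType) (A G : {group gT}) :
  sigma_subnormal s A G -> Hall_Pi s Pi G A -> A <| G.
Proof.
rewrite /Hall_Pi; elim=> [_|B C ssnAB IH sBC stepBC hallA].
  exact: normal_refl.
have sAB := sigma_subnormal_sub ssnAB.
have hallAB := pHall_subl sAB sBC hallA.
have nAB := IH hallAB.
case: stepBC => [nBC | /sigma_primary_gcoreP[i piC]].
  by rewrite -(normal_Hall_pcore hallAB nAB) gFnormal_trans.
have nXC := gcore_normal sBC; have sXB := gcore_sub B C.
have [Pi_i | Pi'i] := boolP (Pi i).
  suff sCB : C \subset B.
    by rewrite (_ : C = B) //; apply/val_inj/eqP; rewrite eqEsubset sCB.
  rewrite -indexg_eq1; apply/eqP/(@pnat_1 (Defs.pi_of s Pi)).
    apply: sub_in_pnat (pnat_dvd (indexgS C sXB) piC) => p _ /eqP s_p.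
    by rewrite /in_mem /= s_p.
  by have [_ _] := and3P hallA; apply: pnat_dvd; apply: indexgS.
have sAX : A \subset gcore B C.
  rewrite -quotient_sub1 ?(subset_trans (pHall_sub hallA) (normal_norm nXC)) //.
  apply/trivgP/card1_trivg/(@pnat_1 (Defs.pi_of s Pi)).
    exact: quotient_pgroup (pHall_pgroup hallA).
  apply: (pnat_dvd (cardSg (quotientS _ (pHall_sub hallA)))).
  rewrite card_quotient ?normal_norm //.
  apply: sub_in_pnat piC => p _ /eqP s_p.
  by rewrite inE /= /in_mem /= s_p.
have hallAX := pHall_subl sAX (normal_sub nXC) hallA.
by rewrite -(normal_Hall_pcore hallAX) ?gFnormal_trans // (normalS sAX sXB).
Qed.

(** * Permutable subgroups are sigma-subnormal *)

(** The stabiliser of the set [J * Q] under right translation is a group containing [A], [B] and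
    [Q], hence [J <*> Q]. As [1] is in [J * Q], this forces [J <*> Q] into [J * Q]. *)
Lemma commute_joing (gT : finGroupType) (A B Q : {group gT}) :
  commute A Q -> commute B Q -> commute (A <*> B) Q.
Proof.
move=> cAQ cBQ; rewrite -[A <*> B]/(gval (A <*> B)%G); set J := (A <*> B)%G.
have sAJ : A \subset J by apply: joing_subl.
have sBJ : B \subset J by apply: joing_subr.
have stabJQ (C : {group gT}) :
    commute C Q -> C \subset J -> C \subset 'C[J * Q | 'Rs].
  move=> cCQ sCJ; apply/subsetP=> x Cx; apply/astab1P.
  apply/eqP; rewrite /= rcosetE eqEcard card_rcoset leqnn andbT.
  apply: (@subset_trans _ _ (J * Q * C)); first by rewrite mulgS ?sub1set.
  by rewrite -mulgA -cCQ mulgA mulGSid.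
have stabQ : Q \subset 'C[J * Q | 'Rs].
  apply/subsetP=> x Qx; apply/astab1P.
  by rewrite /= rcosetE -mulgA rcoset_id.
apply/comm_group_setP.
suff <- : J <*> Q = J * Q by apply: groupP.
apply/eqP; rewrite eqEsubset mul_subG ?joing_subl ?joing_subr // andbT.
have sW : J <*> Q \subset 'C[J * Q | 'Rs].
  by rewrite join_subG stabQ andbT join_subG !stabJQ.
apply/subsetP=> x /(subsetP sW)/astab1P /= <-.
by rewrite rcosetE -[x in x \in _]mul1g mem_mulg ?inE // -[1]mulg1 mem_mulg.
Qed.

(** Let [p] lie outside the class [i] and let [R] be a Hall subgroup for the class of [p]. The index
    of [A] in [A * R] divides both [#|G : A|], an [i]-number, and [#|R|], so [R] lies in [A]. Thus
    [A] contains all Sylow [p]-subgroups, and so does its core. *)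
Lemma Hall_permutable_index_gcore (s : nat -> nat) (gT : finGroupType)
    (G A Q : {group gT}) (i : nat) :
  sigma_full s G -> A \subset G -> Hall_permutable s G A ->
  (sigma_i s i).-Hall(G) Q -> G \subset A * Q ->
  (sigma_i s i).-nat #|G : gcore A G|.
Proof.
move=> fullG sAG permA hallQ sGAQ.
have DG : A * Q = G.
  by apply/eqP; rewrite eqEsubset sGAQ mul_subG ?(pHall_sub hallQ).
have pGA : (sigma_i s i).-nat #|G : A|.
  rewrite -DG indexMg; apply: pnat_dvd (pHall_pgroup hallQ).
  exact: dvdn_indexg.
apply/pnatP=> // p p_pr p_dv; apply/eqP/eqP; apply: contraTT p_dv => neq_spi.
have sSA (P : {group gT}) : p.-Sylow(G) P -> P \subset A.
  move=> sylP; have [sPG pP _] := and3P sylP.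
  have [|R hallR sPR] := @sigma_full_sub_Hall s gT G P (s p) fullG.
    by rewrite /psubgroup sPG pgroup_sigma_i.
  apply: (subset_trans sPR); rewrite -indexg_eq1; apply/eqP.
  apply: (@pnat_1 (sigma_i s i)).
    rewrite -indexMg -comm_joingE; last exact: permA hallR.
    apply: pnat_dvd pGA; rewrite indexSg ?joing_subl //.
    by rewrite join_subG sAG (pHall_sub hallR).
  apply: (@sigma_i_pnatN s (s p) i) => //.
  exact: pnat_dvd (dvdn_indexg R A) (pHall_pgroup hallR).
have [P sylP] := Sylow_exists p G.
have sPX : P \subset gcore A G.
  apply/bigcapsP=> x Gx; rewrite -sub_conjgV.
  by apply: (sSA (P :^ x^-1)%G); rewrite pHallJ ?groupV.
rewrite -p'natE //; have [_ _] := and3P sylP.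
by apply: pnat_dvd; apply: indexgS.
Qed.

Lemma Hall_permutable_joing (s : nat -> nat) (gT : finGroupType)
    (G A B : {group gT}) :
  Hall_permutable s G A -> Hall_permutable s G B ->
  Hall_permutable s G (A <*> B)%G.
Proof.
move=> permA permB i Q hallQ.
have cAQ := permA i Q hallQ; have cBQ := permB i Q hallQ.
exact: commute_joing.
Qed.

Lemma Hall_permutable_conjg (s : nat -> nat) (gT : finGroupType)
    (G A : {group gT}) (x : gT) :
  x \in G -> Hall_permutable s G A -> Hall_permutable s G (A :^ x)%G.
Proof.
move=> Gx permA i Q hallQ; rewrite /commute -[Q : {set gT}](conjsgKV x) /=.
rewrite -!conjsMg; congr (_ :^ x).
by apply: (permA i (Q :^ x^-1)%G); rewrite pHallJ ?groupV.
Qed.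

(* A group [A] that some Hall subgroup [Q] fails to normalise is enlarged inside
   [A * Q] to the join of [A] with a conjugate, which is still permutable; either
   this join is proper, or [G = A * Q]. *)
Lemma Hall_permutable_sigma_subnormal (s : nat -> nat) (gT : finGroupType)
    (G A : {group gT}) :
  sigma_full s G -> A \subset G -> Hall_permutable s G A ->
  sigma_subnormal s A G.
Proof.
have [n] := ubnP #|G : A|; elim: n => // n IHn in G A * => leGAn fullG sAG permA.
have [nAG | not_nAG] := boolP (A <| G).
  by apply: (ssn_step (ssn_refl s A) sAG); left.
(* Sylow subgroups generate [G], so they cannot all normalise [A]. *)
have /existsP[P /andP[/SylowP[p p_pr sylP] not_nAP]] :
    [exists P : {group gT}, Sylow G P && ~~ (P \subset 'N(A))].
  apply: contraR not_nAG => /existsPn nA; rewrite /normal sAG -Sylow_gen.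
  rewrite gen_subG; apply/bigcupsP=> P sylP.
  by have := nA P; rewrite sylP negbK.
have [sPG pP _] := and3P sylP.
have [|Q hallQ sPQ] := @sigma_full_sub_Hall s gT G P (s p) fullG.
  by rewrite /psubgroup sPG pgroup_sigma_i.
have [x Px nAx] := subsetPn not_nAP.
have Gx := subsetP sPG x Px.
pose B := (A <*> A :^ x)%G.
have sAB : A \subset B := joing_subl _ _.
have sBG : B \subset G by rewrite join_subG sAG conj_subG.
have permB : Hall_permutable s G B.
  exact: (Hall_permutable_joing permA (Hall_permutable_conjg Gx permA)).
have neqAB : ~~ (B \subset A).
  apply: contra nAx => sBA; rewrite inE.
  exact: subset_trans (joing_subr _ _) sBA.
have idxBA : 1 < #|B : A| by rewrite indexg_gt1.
have Dindex : (#|G : B| * #|B : A|)%N = #|G : A| by exact: Lagrange_index.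
have [sGB | not_sGB] := boolP (G \subset B).
  apply: (ssn_step (ssn_refl s A) sAG); right.
  apply: (sigma_primary_gcore (gcore_normal sAG) (gcore_sub _ _)).
  apply: (Hall_permutable_index_gcore fullG sAG permA hallQ).
  have cAQ := permA _ Q hallQ.
  rewrite -comm_joingE //; apply: subset_trans sGB _.
  rewrite join_subG joing_subl conj_subG ?joing_subl //.
  by rewrite (subsetP (joing_subr A Q)) ?(subsetP sPQ).
have idxGB : 1 < #|G : B| by rewrite indexg_gt1.
(* Both [#|G : B|] and [#|B : A|] are proper divisors of [#|G : A|], so induction applies to each
   link. *)
apply: (@sigma_subnormal_trans s gT A B G); apply: IHn => //.
- rewrite -ltnS; apply: leq_trans leGAn; rewrite ltnS -Dindex.
  by rewrite ltn_Pmull.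
- exact: sigma_full_sub fullG.
- exact: Hall_permutable_sub fullG sAB sBG permA.
rewrite -ltnS; apply: leq_trans leGAn; rewrite ltnS -Dindex.
by rewrite ltn_Pmulr.
Qed.

(** * Passage to quotients *)

(** A Hall subgroup [F] of the preimage [T] of [S] has a Hall image in [S], which is all of [S];
    then [F] extends to a Hall subgroup of [G]. *)
Lemma sigma_full_quotient_sub_Hall (s : nat -> nat) (gT : finGroupType)
    (G D : {group gT}) (S : {group coset_of D}) (i : nat) :
  G \subset 'N(D) -> sigma_full s G -> (sigma_i s i).-subgroup(G / D) S ->
  exists2 Q : {group gT}, (sigma_i s i).-Hall(G) Q & S \subset Q / D.
Proof.
move=> nDG fullG /andP[sSG pS].
pose T := (G :&: coset D @*^-1 S)%G.
have sTG : T \subset G := subsetIl _ _.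
have DS : T / D = S by rewrite /quotient morphim_setIpre (setIidPr sSG).
have [|F hallF _] := @sigma_full_sub_Hall s gT T 1%G i (sigma_full_sub sTG fullG).
  by rewrite /psubgroup sub1G pgroup1.
have [sFT pF _] := and3P hallF; have sFG := subset_trans sFT sTG.
have [|Q hallQ sFQ] := @sigma_full_sub_Hall s gT G F i fullG.
  by rewrite /psubgroup sFG.
exists Q => //; apply: subset_trans (quotientS D sFQ).
have := quotient_pHall (subset_trans sFG nDG) hallF; rewrite DS => hallFD.
have sSF := sub_pHall hallFD pS (pHall_sub hallFD) (subxx S).
by rewrite -sSF.
Qed.

(** Subgroups of [G / D] have the form [L / D], and conjugacy of the Hall subgroups of [L] descends
    to their images. *)
Lemma sigma_full_quotient (s : nat -> nat) (gT : finGroupType)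
    (G D : {group gT}) :
  G \subset 'N(D) -> sigma_full s G -> sigma_full s (G / D)%G.
Proof.
move=> nDG fullG E sEG i _.
pose L := (G :&: coset D @*^-1 E)%G.
have sLG : L \subset G := subsetIl _ _.
have nDL := subset_trans sLG nDG.
have DE : E = (L / D)%G.
  apply/val_inj; rewrite /= /quotient morphim_setIpre; apply/esym/setIidPr.
  exact: sEG.
have fullL := sigma_full_sub sLG fullG.
have [|Q hallQ _] := @sigma_full_sub_Hall s gT L 1%G i fullL.
  by rewrite /psubgroup sub1G pgroup1.
have [sQL _ _] := and3P hallQ.
rewrite DE; exists (Q / D)%G.
  exact: quotient_pHall (subset_trans sQL nDL) hallQ.
move=> S piS.
have [R hallR sSR] := sigma_full_quotient_sub_Hall nDL fullL piS.
have [x Lx DR] := sigma_full_Hall_conj fullL hallR hallQ.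
exists (coset D x); first exact: mem_quotient.
by rewrite /= -quotientJ ?(subsetP nDL) // -DR.
Qed.

Lemma Hall_permutable_quotient (s : nat -> nat) (gT : finGroupType)
    (G D A : {group gT}) :
  G \subset 'N(D) -> sigma_full s G -> A \subset G ->
  Hall_permutable s G A -> Hall_permutable s (G / D)%G (A / D)%G.
Proof.
move=> nDG fullG sAG permA i S hallS.
have [|Q hallQ sSQ] := @sigma_full_quotient_sub_Hall s gT G D S i nDG fullG.
  by have [sSG pS _] := and3P hallS; apply/andP.
have [sQG pQ _] := and3P hallQ.
have <- : Q / D = S.
  apply: (sub_pHall hallS) => //; first exact: quotient_pgroup.
  exact: quotientS.
have [nDA nDQ] := (subset_trans sAG nDG, subset_trans sQG nDG).
by rewrite /commute /= -!quotientMl // (permA i Q hallQ).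
Qed.

Lemma sigma_quasinormal_quotient (s : nat -> nat) (gT : finGroupType)
    (G D A : {group gT}) :
  G \subset 'N(D) -> sigma_full s G ->
  sigma_quasinormal s A G -> sigma_quasinormal s (A / D)%G (G / D)%G.
Proof.
move=> nDG fullG /(sigma_quasinormal_Hall_permutable _ fullG)[sAG permA].
apply/sigma_quasinormal_Hall_permutable; first exact: sigma_full_quotient.
by split; [apply: quotientS | apply: Hall_permutable_quotient].
Qed.

(** * Commutation in the presence of a normal Hall subgroup *)

(* [K] centralises [D], so it lies in [O := 'O_pi^'('C_G(D))], which is a Hall
   subgroup of ['C_G(D)] because [D :&: 'C_G(D)] is central with a complement.
   As [O * Q] is a [pi^']-group, [D * (K * Q)] meets it in [K * Q]. *)
Lemma commute_mod_normal_Hall (pi : nat_pred) (gT : finGroupType)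
    (G D K Q : {group gT}) :
  D <| G -> pi.-Hall(G) D -> K \subset G -> K :&: D = 1 -> D \subset 'N(K) ->
  Q \subset G -> pi^'.-group Q -> D * (K * Q) = D * (Q * K) -> commute K Q.
Proof.
move=> nDG hallD sKG tiKD nKD sQG p'Q eqDKQ.
(* The trivial group [K :&: D] is a Hall [pi]-subgroup of [K]. *)
have p'K : pi^'.-group K.
  have := setI_normal_Hall nDG hallD sKG; rewrite setIC tiKD.
  by case/and3P=> _ _; rewrite indexg1.
have cKD : K \subset 'C(D).
  apply/commG1P/trivgP; rewrite -tiKD commg_subI // subsetI.
    by rewrite subxx (subset_trans sKG) ?normal_norm.
  by rewrite subxx.
pose C := 'C_G(D)%G.
have nCG : C <| G.
  by rewrite /normal subsetIl normsI ?normG ?norms_cent ?normal_norm.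
have hallZ : pi.-Hall(C) (D :&: C) := setI_normal_Hall nDG hallD (normal_sub nCG).
have nZC : D :&: C <| C.
  rewrite /normal subsetIr normsI ?normG //.
  by rewrite (subset_trans (normal_sub nCG)) ?normal_norm.
have /splitsP[X complX] := SchurZassenhaus_split (pHall_Hall hallZ) nZC.
have hallX : pi^'.-Hall(C) X by rewrite -(compl_pHall _ hallZ).
have sXC := pHall_sub hallX; have [_ DC] := complP complX.
have nXC : X <| C.
  rewrite /normal sXC -DC mulG_subG normG andbT cents_norm // centsC.
  rewrite (subset_trans sXC) // (subset_trans (subsetIr G _)) //.
  by rewrite centS // subsetIl.
pose O := 'O_pi^'(C)%G.
have nOG : O <| G by apply: gFnormal_trans.
have sKO : K \subset O.
  rewrite /= (normal_Hall_pcore hallX nXC) (sub_normal_Hall hallX nXC) //.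
  by rewrite subsetI sKG.
have DJ : O <*> Q = O * Q.
  by rewrite norm_joinEr // (subset_trans sQG) ?normal_norm.
have tiDJ : D :&: (O <*> Q) = 1.
  apply: coprime_TIg; apply: (@pnat_coprime pi); first exact: pHall_pgroup hallD.
  by change (pi^'.-group (O <*> Q)); rewrite DJ pgroupM pcore_pgroup.
have sKJ : K \subset O <*> Q := subset_trans sKO (joing_subl _ _).
have sQJ : Q \subset O <*> Q := joing_subr _ _.
(* If [a = d * b], then [d] is in both [D] and [O <*> Q], which meet trivially. *)
have modD (A B : {set gT}) : A \subset O <*> Q -> B \subset O <*> Q ->
    A \subset D * B -> A \subset B.
  move=> sAJ sBJ /subsetP sADB; apply/subsetP=> a Aa.
  have /mulsgP[d b Dd Bb Da] := sADB a Aa.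
  have : d \in D :&: (O <*> Q).
    rewrite inE Dd -(mulgK b d) -Da groupM ?groupV //.
      exact: (subsetP sAJ).
    exact: (subsetP sBJ).
  by rewrite tiDJ => /set1P d1; rewrite Da d1 mul1g.
have [sKQJ sQKJ] := (mul_subG sKJ sQJ, mul_subG sQJ sKJ).
apply/eqP; rewrite eqEsubset; apply/andP; split; apply: modD => //.
  by rewrite -eqDKQ mulG_subr.
by rewrite eqDKQ mulG_subr.
Qed.

(** [K] is a Pi'-group because [K :&: D] is Hall in it, and its index in [K * D] divides [#|D|]; so
    it is a sigma-subnormal Hall subgroup of [K * D]. *)
Lemma sigma_subnormal_normal_Hall_norm (s : nat -> nat) (Pi : pred nat)
    (gT : finGroupType) (G D K : {group gT}) :
  D <| G -> Hall_Pi s Pi G D -> sigma_subnormal s K G -> K :&: D = 1 ->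
  D \subset 'N(K).
Proof.
move=> nDG hallD ssnKG tiKD.
have sKG := sigma_subnormal_sub ssnKG.
have DKD : K <*> D = K * D.
  by rewrite norm_joinEl // (subset_trans sKG) ?normal_norm.
have DM : (G :&: (K <*> D))%G = (K <*> D)%G.
  by apply/val_inj/setIidPr; rewrite join_subG sKG normal_sub.
have DK : (K :&: (K <*> D))%G = K by apply/val_inj/setIidPl/joing_subl.
have := sigma_subnormal_setI (K <*> D)%G ssnKG; rewrite DM DK => ssnKM.
suff /normal_norm/joing_subP[] : K <| K <*> D by [].
apply: (@sigma_subnormal_Hall_normal s (predC Pi) gT) => //.
apply/and3P; split; first exact: joing_subl.
  have := setI_normal_Hall nDG hallD sKG; rewrite setIC tiKD.
  case/and3P=> _ _; rewrite indexg1; exact: sub_in_pnat.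
rewrite /= DKD indexMg; apply: (pnat_dvd (dvdn_indexg D K)).
apply: sub_in_pnat (pHall_pgroup hallD) => p _ Pi_p.
by rewrite /in_mem /= /in_mem /= negbK.
Qed.

(** Both sides are full preimages of the same set in the quotient. *)
Lemma commute_quotient_mul (gT : finGroupType) (N K Q : {group gT}) :
  K \subset 'N(N) -> Q \subset 'N(N) -> commute (K / N) (Q / N) ->
  N * (K * Q) = N * (Q * K).
Proof.
move=> nNK nNQ cKQ.
rewrite -(quotientK (mul_subG nNK nNQ)) -(quotientK (mul_subG nNQ nNK)).
by rewrite !quotientMl // cKQ.
Qed.

Lemma commute_quotient (gT : finGroupType) (N K Q : {group gT}) :
  N <| K -> Q \subset 'N(N) -> commute (K / N) (Q / N) -> commute K Q.
Proof.
case/andP=> sNK nNK nNQ cKQ.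
have := commute_quotient_mul nNK nNQ cKQ.
by rewrite !mulgA (mulSGid sNK) -(normC nNQ) -mulgA (mulSGid sNK).
Qed.

(** * Transitivity of sigma-quasinormality in [G] *)

Theorem theoremA (s : nat -> nat) (gT : finGroupType) (G D : {group gT}) :
  D <| G ->
  sigma_Hall s G D ->
  PsT s (G / D)%G ->
  (forall H : {group gT}, sigma_subnormal s H D -> H <| G) ->
  sigma_full s G ->
  PsT s G.
Proof.
move=> nDG [Pi hallD] PsTGD ssnD_normal fullG K H sqKH sqHG.
have [sHG permH] := (sigma_quasinormal_Hall_permutable H fullG).1 sqHG.
have fullH := sigma_full_sub sHG fullG.
have [sKH permK] := (sigma_quasinormal_Hall_permutable K fullH).1 sqKH.
have sKG := subset_trans sKH sHG.
have nD := normal_norm nDG.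
have ssnKG : sigma_subnormal s K G.
  exact: sigma_subnormal_trans (Hall_permutable_sigma_subnormal fullH sKH permK)
    (Hall_permutable_sigma_subnormal fullG sHG permH).
have sqKD : sigma_quasinormal s (K / D)%G (G / D)%G.
  apply: (PsTGD _ (H / D)%G); last exact: sigma_quasinormal_quotient.
  by apply: sigma_quasinormal_quotient => //; apply: subset_trans nD.
have [_ permKD] :=
  (sigma_quasinormal_Hall_permutable _ (sigma_full_quotient nD fullG)).1 sqKD.
pose N := (K :&: D)%G.
have nNG : N <| G.
  apply: ssnD_normal; have := sigma_subnormal_setI D ssnKG.
  by rewrite (_ : (G :&: D)%G = D) //; apply/val_inj/setIidPr/normal_sub.
have nN := normal_norm nNG.
have sNK : N \subset K := subsetIl K D.
apply/sigma_quasinormal_Hall_permutable => //; split=> // i Q hallQ.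
have [sQG pQ _] := and3P hallQ.
have [nDQ nNQ] := (subset_trans sQG nD, subset_trans sQG nN).
have [nDK nNK] := (subset_trans sKG nD, subset_trans sKG nN).
have cKQD : commute (K / D) (Q / D).
  exact: permKD (quotient_pHall nDQ hallQ).
(* Pulled back to sets in [G], the relation can be pushed down modulo [N] without comparing [G / D]
   with the double quotient. *)
have eqDKQ := commute_quotient_mul nDK nDQ cKQD.
(* Since [N] lies in [K], commutation may be tested modulo [N], where [K] and [D] meet trivially. *)
apply: (@commute_quotient _ N); rewrite /normal ?sNK //.
have nDqG : D / N <| G / N by apply: quotient_normal.
have hallDq : Hall_Pi s Pi (G / N) (D / N).
  by apply: quotient_pHall => //; apply: subset_trans (normal_sub nDG) nN.
have tiKDq : K / N :&: D / N = 1 by rewrite -quotientGI // trivg_quotient.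
have nKDq : D / N \subset 'N(K / N).
  apply: (sigma_subnormal_normal_Hall_norm nDqG hallDq _ tiKDq).
  exact: sigma_subnormal_quotient.
have [Pi_i | Pi'i] := boolP (Pi i).
  have sQD : Q \subset D.
    rewrite (sub_normal_Hall hallD nDG) //.
    by apply: sub_in_pnat pQ => p _ /eqP s_p; rewrite /in_mem /= s_p.
  by apply/esym/normC; apply: subset_trans (quotientS N sQD) nKDq.
apply: (commute_mod_normal_Hall nDqG hallDq) => //; try exact: quotientS.
  apply: quotient_pgroup; apply: sub_in_pnat pQ => p _ /eqP s_p.
  by rewrite inE /= /in_mem /= s_p.
have nND := subset_trans (normal_sub nDG) nN.
by rewrite -!quotientMl // eqDKQ.
Qed.
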